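(* Let $\mathcal M=(\mathcal P,q_\cap,\max)$ be a preficient MSP with intersection quality, and let $\mathcal B$ be a polynomial-time preficiency algorithm for it. Then the two-loop algorithm described in the context is a polynomial-time $\big(1/\sqrt{2\chi}\big)$-approximation algorithm for $\mathcal M|_2$, i.e. for every 2-stage instance $\mathcal G=(G_1,G_2)$ it outputs in polynomial time a pair $(S_1,S_2)\in f^*(G_1)\times f^*(G_2)$ with $|S_1\cap S_2|\ge \frac{1}{\sqrt{2\chi}}\max\{|S'_1\cap S'_2|\mid (S'_1,S'_2)\in f^*(G_1)\times f^*(G_2)\}$, where $\chi=|X_1\cap X_2|$.
   Context: A graph's element set is $X(G)=V(G)\cup E(G)$. A Subgraph Problem (SP) is $\mathcal P=(\mathbb G,f,m,\psi)$: $\mathbb G$ a class of enriched (e.g. weighted) graphs, $f(G)\subseteq 2^{X(G)}$ feasible solutions, $m$ a measure, $\psi\in\{\min,\max\}$; $f^*(G)$ is the set of optimal feasible solutions. A Multistage Subgraph Problem (MSP) $\mathcal M=(\mathcal P,q,\Psi)$ has as instances multistage graphs $\mathcal G=(G_i)_{i\in[\tau]}\in\mathbb G^\tau$, $\tau\ge2$, $G_i=(V_i,E_i)$, $X_i=V_i\cup E_i$; feasible multistage solutions are tuples $(S_i)$ with $S_i\in f^*(G_i)$ for all $i$, and the goal is to optimize (according to $\Psi$) $Q(\mathcal S)=\sum_{i\in[\tau-1]}q(S_i,S_{i+1})$. Here $q=q_\cap$ with $q_\cap(A,B)=|A\cap B|$ and $\Psi=\max$. $\mathcal M|_2$ is the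 restriction to 2-stage instances. The intertwinement is $\chi=\max_{i\in[\tau-1]}|X_i\cap X_{i+1}|$; for two stages $\chi=|X_\cap|$ with $X_\cap=X_1\cap X_2$. $\mathcal M$ is preficient if there is a polynomial-time algorithm $\mathcal B(G,Y)$ which, given $G\in\mathbb G$ and $Y\subseteq\{x\in S\mid S\in f^*(G)\}$, computes $S\in f^*(G)$ with $q(Y,S)=\Psi\{q(Y,S')\mid S'\in f^*(G)\}$ (here: $S$ maximizes $|Y\cap S|$ among optimal solutions). The algorithm: initialize the current best pair $(S_1,S_2)$ as empty. First loop: for each $x\in X_\cap$, set $S'_1=\mathcal B(G_1,\{x\})$, $S'_2=\mathcal B(G_2,S'_1)$, and replace the current best by $(S'_1,S'_2)$ if $|S'_1\cap S'_2|\ge|S_1\cap S_2|$. Second loop, for $i=1,2,\dots$: set $Y=X_\cap\setminus\bigcup_{j<i}S_1^{(j)}$, $S_1^{(i)}=\mathcal B(G_1,Y)$; if $|S_1^{(i)}\cap Y|=0$, return the current best pair; otherwise set $S_2^{(i)}=\mathcal B(G_2,S_1^{(i)})$ and replace the current best by $(S_1^{(i)},S_2^{(i)})$ if $|S_1^{(i)}\cap S_2^{(i)}|\ge |S_1\cap S_2|$.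
   Formalization: B is required to be correct for every Y contained in X(H) for some graph H of the class, since the algorithm queries sets outside the union of optimal solutions; for χ=0 (ratio undefined, empty pair returned) only polynomial-time termination is claimed. *)

(* Defs.v *)
From HB Require Import structures.
From Stdlib Require Import BinPos BinPosDef.
From mathcomp Require Import all_boot all_order all_algebra finmap.

Set Implicit Arguments.
Unset Strict Implicit.
Unset Printing Implicit Defensive.

Import Order.TTheory GRing.Theory Num.Theory.

Local Open Scope fset_scope.
Local Open Scope nat_scope.

(** * Machine model

    Running times refer to Jones' WHILE language on binary trees, extended with
    calls to closed subprograms.  An operation is charged the sizes of the trees
    it evaluates, so no tree can be built more cheaply than by writing it down:
    with this charge the model and Turing machines simulate each other with
    polynomial overhead, for functions as well as for decision problems. *)

Inductive data : Type := Leaf | Node of data & data.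

Fixpoint data_eqb (a b : data) : bool :=
  match a, b with
  | Leaf, Leaf => true
  | Node a1 a2, Node b1 b2 => data_eqb a1 b1 && data_eqb a2 b2
  | _, _ => false
  end.

Lemma data_eqP : Equality.axiom data_eqb.
Proof.
elim=> [|a1 IH1 a2 IH2] [|b1 b2]; try by constructor.
by apply: (iffP andP) => [[/IH1-> /IH2->] // | [<- <-]]; split; [apply/IH1|apply/IH2].
Qed.

HB.instance Definition _ := hasDecEq.Build data data_eqP.

Fixpoint dsize (a : data) : nat :=
  if a is Node a1 a2 then (dsize a1 + dsize a2).+1 else 1.

Definition dtrue : data := Node Leaf Leaf.

Definition dlist (s : seq data) : data := foldr Node Leaf s.

(** Variables are numbered; variable 0 carries the input of a program when it
    starts and its output when it halts. *)
Definition var := nat.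
Definition store := var -> data.
Definition init (d : data) : store := fun x => if x == 0 then d else Leaf.
Definition update (st : store) (x : var) (d : data) : store :=
  fun y => if y == x then d else st y.

Inductive expr : Type :=
  | Var of var
  | ENil
  | ECons of expr & expr
  | Hd of expr
  | Tl of expr
  | Eq of expr & expr.

Fixpoint eval (st : store) (e : expr) : data :=
  match e with
  | Var x => st x
  | ENil => Leaf
  | ECons a b => Node (eval st a) (eval st b)
  | Hd a => if eval st a is Node u _ then u else Leaf
  | Tl a => if eval st a is Node _ v then v else Leaf
  | Eq a b => if eval st a == eval st b then dtrue else Leaf
  end.

Fixpoint ecost (st : store) (e : expr) : nat :=
  dsize (eval st e) +
  match e with
  | Var _ | ENil => 0
  | ECons a b | Eq a b => ecost st a + ecost st b
  | Hd a | Tl a => ecost st a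
  end.

(** [Call x c e] runs [c] on the value of [e] in a fresh store and assigns its
    output to [x]; the caller's other variables are not affected. *)
Inductive cmd : Type :=
  | Skip
  | Assign of var & expr
  | Seq of cmd & cmd
  | If of expr & cmd & cmd
  | While of expr & cmd
  | Call of var & cmd & expr.

(** [exec c st st' t]: started in [st], [c] halts in [st'] after time [t]. *)
Inductive exec : cmd -> store -> store -> nat -> Prop :=
  | exec_skip st : exec Skip st st 1
  | exec_assign st x e :
      exec (Assign x e) st (update st x (eval st e)) (ecost st e)
  | exec_seq st st1 st2 c1 c2 t1 t2 :
      exec c1 st st1 t1 -> exec c2 st1 st2 t2 ->
      exec (Seq c1 c2) st st2 (t1 + t2)
  | exec_if st st1 e c1 c2 t :
      exec (if eval st e == Leaf then c2 else c1) st st1 t ->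
      exec (If e c1 c2) st st1 (ecost st e + t)
  | exec_while_stop st e c :
      eval st e = Leaf -> exec (While e c) st st (ecost st e)
  | exec_while_step st st1 st2 e c t1 t2 :
      eval st e <> Leaf -> exec c st st1 t1 -> exec (While e c) st1 st2 t2 ->
      exec (While e c) st st2 (ecost st e + t1 + t2)
  | exec_call st st1 x c e t :
      exec c (init (eval st e)) st1 t ->
      exec (Call x c e) st (update st x (st1 0)) (ecost st e + t + dsize (st1 0)).

(** [runs c a b t]: on input [a], the program [c] halts with output [b] after
    time [t]. *)
Definition runs (c : cmd) (a b : data) (t : nat) : Prop :=
  exists2 st, exec c (init a) st t & st 0 = b.

(** * Enriched graphs *)

Definition element := (nat + {fset nat})%type.

Record graph := Graph {
  vertices : {fset nat};
  edges : {fset {fset nat}};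
  edgesP : forall e, e \in edges -> e `<=` vertices /\ #|` e| = 2
}.

(** The enrichment (weights, terminals, ...) is arbitrary finite data; how it is
    read is up to the class of graphs, the feasibility and the measure. *)
Record egraph := EGraph { base_graph :> graph; enrichment : data }.

Definition elements (G : graph) : {fset element} :=
  [fset inl v | v in vertices G] `|` [fset inr e | e in edges G].

Fixpoint code_pos (p : positive) : data :=
  match p with
  | xH => Leaf
  | xO q => Node Leaf (code_pos q)
  | xI q => Node dtrue (code_pos q)
  end.

(** Binary notation of [n + 1]. *)
Definition code_nat (n : nat) : data := code_pos (Pos.of_succ_nat n).

Definition code_element (x : element) : data :=
  match x with
  | inl v => Node Leaf (code_nat v)
  | inr e => Node dtrue (dlist [seq code_nat v | v <- sort leq (enum_fset e)])
  end.

(** A set is coded by any duplicate-free list of its elements, in any order. *)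
Definition codes_set (d : data) (S : {fset element}) : Prop :=
  exists s : seq element,
    [/\ uniq s, S =i s & d = dlist [seq code_element x | x <- s]].

(** Vertices and edges are tagged differently, so [elements G] determines [G]. *)
Definition codes_egraph (d : data) (G : egraph) : Prop :=
  exists2 a, codes_set a (elements G) & d = Node a (enrichment G).

(** * Subgraph problems and multistage subgraph problems *)

Inductive goal : Type := Min | Max.

Definition no_worse (R : rcfType) (g : goal) (x y : R) : bool :=
  if g is Min then (x <= y)%R else (y <= x)%R.

(** The members of [A] attaining the minimum, resp. maximum, of [F] over [A]. *)
Definition optima (R : rcfType) (T : choiceType) (g : goal) (F : T -> R)
    (A : {fset T}) : {fset T} :=
  [fset S in A | all (fun S' => no_worse g (F S) (F S')) (enum_fset A)].

Record sp (R : rcfType) := SP {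
  sp_class : egraph -> Prop;
  sp_feasible : egraph -> {fset {fset element}};
  sp_measure : egraph -> {fset element} -> R;
  sp_goal : goal;
  sp_feasibleP : forall G, sp_class G ->
    forall S, S \in sp_feasible G -> S `<=` elements G
}.

Definition optimal_solutions (R : rcfType) (P : sp R) (G : egraph) :
    {fset {fset element}} :=
  optima (sp_goal P) (sp_measure P G) (sp_feasible P G).

Record msp (R : rcfType) := MSP {
  msp_sp : sp R;
  msp_quality : {fset element} -> {fset element} -> R;
  msp_goal : goal
}.

Definition q_cap (R : rcfType) (A B : {fset element}) : R :=
  (#|` A `&` B|)%:R%R.

(** [B] is a polynomial-time preficiency algorithm for [M].  The query [Y] may be
    any set of elements of a graph [H] of the class, and not only a subset of the
    union of the optimal solutions of [G]: an algorithm that queries [G2] with a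
    solution of [G1], or [G1] with an arbitrary common element, leaves that
    union.  Optimal solutions exist for every [G] in the class, as [B] has to
    produce one. *)
Definition preficiency_algorithm (R : rcfType) (M : msp R) (B : cmd) : Prop :=
  exists p : {poly nat},
  forall (G H : egraph) (Y : {fset element}) (dG dY : data),
    sp_class (msp_sp M) G -> sp_class (msp_sp M) H -> Y `<=` elements H ->
    codes_egraph dG G -> codes_set dY Y ->
    exists (dS : data) (S : {fset element}) (t : nat),
      [/\ runs B (Node dG dY) dS t,
          t <= p.[dsize (Node dG dY)]%R,
          codes_set dS S
        & S \in optima (msp_goal M) (msp_quality M Y)
                  (optimal_solutions (msp_sp M) G)].

Definition intertwinement (G1 G2 : egraph) : nat :=
  #|` elements G1 `&` elements G2|.

(** * The two-loop algorithm *)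

Declare Scope cmd_scope.
Delimit Scope cmd_scope with cmd.
Notation "x ::= e" := (Assign x e) (at level 60, no associativity) : cmd_scope.
Notation "c1 ;; c2" := (Seq c1 c2) (at level 65, right associativity) : cmd_scope.
Local Open Scope cmd_scope.

Definition Tru : expr := ECons ENil ENil.

(** Input [(x, l)]; output true iff [x] is a member of the list [l]. *)
Definition mem_prog : cmd :=
  let io := 0 in let x := 1 in let l := 2 in let r := 3 in
  x ::= Hd (Var io) ;;
  l ::= Tl (Var io) ;;
  r ::= ENil ;;
  While (Var l) (
    If (Eq (Var x) (Hd (Var l))) (r ::= Tru) Skip ;;
    l ::= Tl (Var l)) ;;
  io ::= Var r.

(** Input [(a, b)]; output the members of [a] that belong to [b] ([keep] true),
    resp. that do not belong to [b] ([keep] false). *)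
Definition sieve_prog (keep : bool) : cmd :=
  let io := 0 in let a := 1 in let b := 2 in let r := 3 in let m := 4 in
  let take := r ::= ECons (Hd (Var a)) (Var r) in
  a ::= Hd (Var io) ;;
  b ::= Tl (Var io) ;;
  r ::= ENil ;;
  While (Var a) (
    Call m mem_prog (ECons (Hd (Var a)) (Var b)) ;;
    If (Var m) (if keep then take else Skip) (if keep then Skip else take) ;;
    a ::= Tl (Var a)) ;;
  io ::= Var r.

Definition inter_prog : cmd := sieve_prog true.
Definition diff_prog : cmd := sieve_prog false.

(** Input [(a, b)]; output true iff the list [a] is at most as long as [b]. *)
Definition short_prog : cmd :=
  let io := 0 in let a := 1 in let b := 2 in let r := 3 in
  a ::= Hd (Var io) ;;
  b ::= Tl (Var io) ;;
  r ::= Tru ;;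
  While (Var a) (
    If (Var b) Skip (r ::= ENil) ;;
    a ::= Tl (Var a) ;;
    b ::= Tl (Var b)) ;;
  io ::= Var r.

(** [(s1, s2)] is the current best pair and [(t1, t2)] the new one.  The set
    [Y] of the second loop is obtained by removing the solutions [t1] one after
    the other. *)
Definition two_loop (B : cmd) : cmd :=
  let io := 0 in let g1 := 1 in let g2 := 2 in let common := 3 in
  let s1 := 4 in let s2 := 5 in let t1 := 6 in let t2 := 7 in
  let todo := 8 in let y := 9 in let hit := 10 in
  let old := 11 in let new := 12 in let better := 13 in
  let keep_best :=
    Call old inter_prog (ECons (Var s1) (Var s2)) ;;
    Call new inter_prog (ECons (Var t1) (Var t2)) ;;
    Call better short_prog (ECons (Var old) (Var new)) ;;
    If (Var better) (s1 ::= Var t1 ;; s2 ::= Var t2) Skip in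
  g1 ::= Hd (Var io) ;;
  g2 ::= Tl (Var io) ;;
  Call common inter_prog (ECons (Hd (Var g1)) (Hd (Var g2))) ;;
  s1 ::= ENil ;;
  s2 ::= ENil ;;
  todo ::= Var common ;;
  While (Var todo) (
    Call t1 B (ECons (Var g1) (ECons (Hd (Var todo)) ENil)) ;;
    Call t2 B (ECons (Var g2) (Var t1)) ;;
    keep_best ;;
    todo ::= Tl (Var todo)) ;;
  y ::= Var common ;;
  Call t1 B (ECons (Var g1) (Var y)) ;;
  Call hit inter_prog (ECons (Var t1) (Var y)) ;;
  While (Var hit) (
    Call t2 B (ECons (Var g2) (Var t1)) ;;
    keep_best ;;
    Call y diff_prog (ECons (Var y) (Var t1)) ;;
    Call t1 B (ECons (Var g1) (Var y)) ;;
    Call hit inter_prog (ECons (Var t1) (Var y))) ;;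
  io ::= ECons (Var s1) (Var s2).

(* Main.v *)
(** Let [opt = #|T1 & T2|] for optimal solutions [T1], [T2], let [X] be the set of
    common elements and [A] the value of the current best pair.  As long as
    [Y] is the set of elements not yet removed by the second loop,
      [opt ^ 2 <= 2 * A * (#|X| - #|Y|) + #|T1 & T2 & Y| ^ 2].
    At the end no optimal solution of [G1] meets [Y], so [opt ^ 2 <= 2 * A * #|X|],
    and [A <= A ^ 2] as [A] is an integer.  The first loop only serves to make the
    current best pair optimal when [X] is not empty.

    For the running time, every value that is stored is at most as large as the
    input, since it codes a set of elements of [G1] or of [G2]; and each
    loop runs at most [#|X|] times. *)

Require Import Defs.
From mathcomp Require Import all_boot all_order all_algebra finmap.
From mathcomp Require Import zify.
From Stdlib Require Import Pnat.

Set Implicit Arguments.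
Unset Strict Implicit.
Unset Printing Implicit Defensive.

Import Order.TTheory GRing.Theory Num.Theory.

Local Open Scope fset_scope.
Local Open Scope nat_scope.

(** * Triples for bounded programs *)

Definition bounded (N : nat) (st : store) := forall x, dsize (st x) <= N.

Lemma dsize_gt0 d : 0 < dsize d.
Proof. by case: d. Qed.

Lemma bounded_update N st x d :
  bounded N st -> dsize d <= N -> bounded N (update st x d).
Proof. by move=> bst dN y; rewrite /update; case: ifP. Qed.

Lemma bounded_init N d : dsize d <= N -> bounded N (init d).
Proof.
by move=> dN x; rewrite /init; case: ifP => // _; apply: leq_trans dN; apply: dsize_gt0.
Qed.

Fixpoint esize (e : expr) : nat :=
  match e with
  | Var _ | ENil => 1
  | ECons a b | Eq a b => (esize a + esize b).+1
  | Hd a | Tl a => (esize a).+1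
  end.

(** The condition [2 < N] covers [Eq], whose value [dtrue] has size 3. *)
Lemma dsize_eval_le N st e :
  2 < N -> bounded N st -> dsize (eval st e) <= esize e * N.
Proof.
move=> N_gt2 bst; elim: e => [x||a IHa b IHb|a IHa|a IHa|a IHa b IHb] /=.
- by rewrite mul1n.
- lia.
- nia.
- by move: IHa; case: (eval st a) => [|u v] /=; nia.
- by move: IHa; case: (eval st a) => [|u v] /=; nia.
- by case: ifP => _ /=; nia.
Qed.

(** Each of the [esize e] subexpressions is charged the size of its value, at most [esize e * N]. *)
Lemma ecost_le N st e :
  2 < N -> bounded N st -> ecost st e <= esize e * esize e * N.
Proof.
move=> N_gt2 bst; have szle := dsize_eval_le _ N_gt2 bst.
elim: e => [x||a IHa b IHb|a IHa|a IHa|a IHa b IHb].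
- by move: (szle (Var x)) => /=; nia.
- by move: (szle ENil) => /=; nia.
- by move: (szle (ECons a b)) => /=; nia.
- by move: (szle (Hd a)) => /=; nia.
- by move: (szle (Tl a)) => /=; nia.
- by move: (szle (Eq a b)) => /=; nia.
Qed.

(* Keeping all variables below [N] makes the cost of an expression linear in [N]. *)
Definition triple (N : nat) (c : cmd) (st : store) (T : nat) (Q : store -> Prop) :=
  bounded N st ->
  exists st' t, [/\ exec c st st' t, t <= T, bounded N st' & Q st'].

Lemma triple_weaken N c st T T' (Q Q' : store -> Prop) :
  triple N c st T Q -> T <= T' -> (forall st', Q st' -> Q' st') ->
  triple N c st T' Q'.
Proof.
move=> tr TT' QQ' /tr[st' [t [ex tT bst' /QQ' Qst']]]; exists st', t.
by split=> //; apply: leq_trans TT'.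
Qed.

(** Makes the bound on the current store, implicit in a triple, available while that triple is being
    proved. *)
Lemma triple_bounded N c st T Q :
  (bounded N st -> triple N c st T Q) -> triple N c st T Q.
Proof. by move=> tr bst; apply: tr. Qed.

Lemma triple_post N c st T (Q Q' : store -> Prop) :
  triple N c st T Q -> (forall st', Q st' -> Q' st') -> triple N c st T Q'.
Proof. by move=> tr QQ'; apply: triple_weaken tr _ QQ'. Qed.

Lemma triple_skip N st (Q : store -> Prop) : Q st -> triple N Skip st 1 Q.
Proof. by move=> Qst bst; exists st, 1; split=> //; constructor. Qed.

(** The triple of [c2] is the postcondition of [c1], so a proof walks through a program from left to
    right. *)
Lemma triple_seq N c1 c2 st T1 T2 Q :
  triple N c1 st T1 (fun st1 => triple N c2 st1 T2 Q) ->
  triple N (Seq c1 c2) st (T1 + T2) Q.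
Proof.
move=> tr /tr[st1 [t1 [ex1 t1T bst1 /(_ bst1)[st2 [t2 [ex2 t2T bst2 Qst2]]]]]].
exists st2, (t1 + t2); split=> //; last lia.
by apply: exec_seq ex1 ex2.
Qed.

Lemma runs_triple N c a b T :
  dsize a <= N -> triple N c (init a) T (fun st => st 0 = b) ->
  exists2 t, t <= T & runs c a b t.
Proof.
move=> aN /(_ (bounded_init aN))[st [t [ex tT _ st0]]].
by exists t => //; exists st.
Qed.

(** * Rules for assignments, branching, loops and calls *)

Section Rules.
Variable N : nat.
Hypothesis N_gt2 : 2 < N.

Lemma triple_assign st x e (Q : store -> Prop) :
  dsize (eval st e) <= N -> Q (update st x (eval st e)) ->
  triple N (Assign x e) st (esize e * esize e * N) Q.
Proof.
move=> eN Qst bst; exists (update st x (eval st e)), (ecost st e); split=> //.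
- by constructor.
- exact: ecost_le.
- exact: bounded_update.
Qed.

(** Charging both branches avoids a maximum in the time bound. *)
Lemma triple_if e c1 c2 st T1 T2 Q :
  (eval st e <> Leaf -> triple N c1 st T1 Q) ->
  (eval st e = Leaf -> triple N c2 st T2 Q) ->
  triple N (If e c1 c2) st (esize e * esize e * N + (T1 + T2)) Q.
Proof.
move=> tr1 tr2 bst; have ce := ecost_le e N_gt2 bst.
have [st' [t [ex tT bst' Qst']]] : exists st' t,
    [/\ exec (if eval st e == Leaf then c2 else c1) st st' t, t <= T1 + T2,
        bounded N st' & Q st'].
  case: eqP => [/tr2|/tr1] /(_ bst)[st' [t [ex tT bst' Qst']]];
    by exists st', t; split=> //; lia.
exists st', (ecost st e + t); split=> //; last lia.
by constructor.
Qed.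

(** The index [k] is a variant bounding the number of iterations left. It may drop by more than one,
    as in the second loop, where one iteration can remove several elements. *)
Lemma triple_while e c T (I : nat -> store -> Prop) (Q : store -> Prop) :
  (forall k st, I k st -> eval st e = Leaf -> Q st) ->
  (forall k st, I k st -> eval st e <> Leaf ->
     triple N c st T (fun st' => exists2 k', k' < k & I k' st')) ->
  forall k st, I k st ->
  triple N (While e c) st
    (esize e * esize e * N + k * (esize e * esize e * N + T)) Q.
Proof.
move=> stop step; elim/ltn_ind=> k IH st Ik bst.
have ce := ecost_le e N_gt2 bst.
case: (eqVneq (eval st e) Leaf) => [e0|/eqP en].
  exists st, (ecost st e); split=> //; last exact: stop Ik e0.
  - exact: exec_while_stop.
  - by apply: leq_trans ce _; apply: leq_addr.
have [st1 [t1 [ex1 t1T bst1 [k' ltk' Ik']]]] := step _ _ Ik en bst.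
have [st2 [t2 [ex2 t2T bst2 Qst2]]] := IH _ ltk' _ Ik' bst1.
exists st2, (ecost st e + t1 + t2); split=> //.
  exact: exec_while_step ex1 ex2.
move: ce t2T; set E := _ * N => ce t2T.
have : k'.+1 * (E + T) <= k * (E + T) by rewrite leq_mul2r ltk' orbT.
by rewrite mulSn; lia.
Qed.

(** The last [N] pays for copying the output. As [c] runs in a fresh store, only its output has to
    respect the bound [N]. *)
Lemma triple_call x c e st T b t (Q : store -> Prop) :
  runs c (eval st e) b t -> t <= T -> dsize b <= N -> Q (update st x b) ->
  triple N (Call x c e) st (esize e * esize e * N + T + N) Q.
Proof.
move=> [st1 ex <-] tT bN Qst bst.
exists (update st x (st1 0)), (ecost st e + t + dsize (st1 0)); split=> //.
- by constructor.
- by have := ecost_le e N_gt2 bst; lia.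
- exact: bounded_update.
Qed.

End Rules.

(** * The list programs *)

Definition data_of_bool (b : bool) : data := if b then dtrue else Leaf.

Lemma size_dlist l : size l <= dsize (dlist l).
Proof. by elim: l => //= x s IH; lia. Qed.

(** Here and below the constants are generous; only polynomial growth matters. *)
Definition mem_time (N : nat) := 99 * N * N.

Lemma mem_prog_runs N x l :
  dsize (Node x (dlist l)) <= N ->
  exists2 t, t <= mem_time N &
    runs mem_prog (Node x (dlist l)) (data_of_bool (x \in l)) t.
Proof.
move=> szN; have N_gt2 : 2 < N.
  by move: szN (dsize_gt0 x) (dsize_gt0 (dlist l)) => /=; lia.
apply: (runs_triple szN).
(* The time is left open: the rules build it up, and its comparison with the bound is proved
   last. *)
apply: triple_weaken; [|shelve|by move=> st'; apply].
apply: triple_seq; apply: triple_assign => //=; first by move: szN => /=; lia.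
apply: triple_seq; apply: triple_assign => //=; first by move: szN => /=; lia.
apply: triple_seq; apply: triple_assign => //=; first lia.
apply: triple_seq.
(* [s] is the part of [l] still to be read, and [b] tells whether [x] was found in the part already
   read. *)
apply: (triple_while N_gt2 (I := fun k st => exists s b,
  [/\ st 1 = x, st 2 = dlist s, size s = k /\ dsize (dlist s) <= N,
      st 3 = data_of_bool b & b || (x \in s) = (x \in l)]) _ _ (k := size l)).
- move=> k st [[|y s] [b [st1 st2 _ st3 eb]]] /=; rewrite st2 // => _.
  apply: triple_assign => //=; first by rewrite st3; case: (b) => /=; lia.
  by rewrite /update /= st3 -eb orbF.
- move=> k st [[|y s] [b [st1 st2 [szs sN] st3 eb]]] /=; rewrite st2 // => _.
  apply: triple_seq; apply: triple_if => //.
  + rewrite /= st1 st2 /=; case: eqP => // exy _.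
    apply: triple_assign => //=; apply: triple_assign => //=.
      by rewrite /update /= st2 /=; move: sN => /=; lia.
    exists (size s); first by rewrite -szs.
    exists s, true; rewrite /update /= st1 st2; split=> //.
      by split=> //; move: sN => /=; lia.
    by rewrite -eb exy inE eqxx orbT.
  + rewrite /= st1 st2 /=; case: eqP => // exy _.
    apply: triple_skip; apply: triple_assign => //=.
      by rewrite st2 /=; move: sN => /=; lia.
    exists (size s); first by rewrite -szs.
    exists s, b; rewrite /update /= st1 st2 st3; split=> //.
      by split=> //; move: sN => /=; lia.
    by rewrite -eb inE; move/eqP/negPf: exy => ->.
- exists l, false; rewrite /update /=; split=> //.
  by split=> //; move: szN => /=; lia.
Unshelve.
rewrite /mem_time /=.
have : size l <= N by move: szN (size_dlist l) => /=; lia.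
nia.
Qed.

(** One factor [N] counts the iterations, the other two come from [mem_prog]. *)
Definition sieve_time (N : nat) := 300 * N * N * N.

Lemma sieve_prog_runs keep N a b :
  dsize (Node (dlist a) (dlist b)) <= N ->
  exists2 t, t <= sieve_time N &
    runs (sieve_prog keep) (Node (dlist a) (dlist b))
      (dlist (rev [seq x <- a | (x \in b) == keep])) t.
Proof.
move=> szN; have N_gt2 : 2 < N.
  by move: szN (dsize_gt0 (dlist a)) (dsize_gt0 (dlist b)) => /=; lia.
apply: (runs_triple szN).
apply: triple_weaken; [|shelve|by move=> st'; apply].
apply: triple_seq; apply: triple_assign => //=; first by move: szN => /=; lia.
apply: triple_seq; apply: triple_assign => //=; first by move: szN => /=; lia.
apply: triple_seq; apply: triple_assign => //=; first lia.
apply: triple_seq.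
pose p x := (x \in b) == keep.
(* [r] collects the selected elements in reverse, hence [catrev]. An element moves from [s] to [r]
   or is dropped, so their joint size never grows; the bound on [s] with [b] makes the argument of
   [mem_prog] fit. *)
apply: (triple_while N_gt2 (I := fun k st => exists s r,
  [/\ st 1 = dlist s, st 2 = dlist b, st 3 = dlist r,
      [/\ size s = k, dsize (dlist s) + dsize (dlist b) < N
        & dsize (dlist r) + dsize (dlist s) <= N]
    & catrev (filter p s) r = rev (filter p a)]) _ _ (k := size a)).
- move=> k st [[|y s] [r [st1 st2 st3 [_ _ rN] er]]] /=; rewrite st1 // => _.
  apply: triple_assign => //=; first by rewrite st3; lia.
  by rewrite /update /= st3 -er.
- move=> k st [[|y s] [r [st1 st2 st3 [szs sbN rN] er]]] /=; rewrite st1 // => _.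
  apply: triple_seq.
  have [t tT runm] : exists2 t, t <= mem_time N &
    runs mem_prog (Node y (dlist b)) (data_of_bool (y \in b)) t.
    by apply: mem_prog_runs; move: sbN => /=; lia.
  apply: (triple_call N_gt2 _ tT); first by rewrite /= st1 st2; apply: runm.
    by case: (_ \in _) => /=; lia.
  set st' := update _ _ _.
  have [st'1 st'2 st'3] : [/\ st' 1 = dlist (y :: s), st' 2 = dlist b & st' 3 = dlist r].
    by split.
  have st'4 : st' 4 = data_of_bool (y \in b) by [].
  clearbody st'.
  (* Both values of [keep] are treated at once: [y] is taken iff [p y]. The 16 is the square of the
     [esize] of the assigned expression. *)
  have take_or_skip T : (p y -> triple N (Assign 3 (ECons (Hd (Var 1)) (Var 3))) st' (16 * N) T)
             -> (~~ p y -> triple N Skip st' (16 * N) T) ->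
     triple N (If (Var 4) (if keep then Assign 3 (ECons (Hd (Var 1)) (Var 3)) else Skip)
        (if keep then Skip else Assign 3 (ECons (Hd (Var 1)) (Var 3)))) st'
        (esize (Var 4) * esize (Var 4) * N + (16 * N + 16 * N)) T.
    move=> htake hskip; apply: triple_if => //=; rewrite st'4.
      by case yb: (y \in b) => // _; move: htake hskip; rewrite /p yb; case: (keep); auto.
    by case yb: (y \in b) => // _; move: htake hskip; rewrite /p yb; case: (keep); auto.
  apply: triple_seq; apply: take_or_skip => py.
    apply: triple_assign => //=.
      by rewrite st'1 st'3 /=; move: rN (dsize_gt0 (dlist s)) => /=; lia.
    apply: triple_assign => //=; rewrite /update /= ?st'1 /=; first by move: sbN => /=; lia.
    exists (size s); first by rewrite -szs.
    exists s, (y :: r); rewrite st'2 st'3; split=> //.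
      by split=> //; move: sbN rN => /=; lia.
    by rewrite -er /= py.
  apply: triple_weaken; [|shelve|by move=> ?; apply].
  apply: triple_skip; apply: triple_assign => //=; rewrite /update /= ?st'1 /=;
    first by move: sbN => /=; lia.
  exists (size s); first by rewrite -szs.
  exists s, r; rewrite st'2 st'3; split=> //.
    by split=> //; move: sbN rN => /=; lia.
  by rewrite -er /= (negPf py).
- exists a, [::]; rewrite /update /=; split=> //.
  by move: szN (dsize_gt0 (dlist b)) => /=; split=> //=; lia.
Unshelve.
- rewrite /sieve_time /mem_time /=.
  have : size a <= N by move: szN (size_dlist a) => /=; lia.
  nia.
- lia.
Qed.

Definition short_time (N : nat) := 99 * N * N.

Lemma short_prog_runs N a b :
  dsize (Node (dlist a) (dlist b)) <= N ->
  exists2 t, t <= short_time N &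
    runs short_prog (Node (dlist a) (dlist b)) (data_of_bool (size a <= size b)) t.
Proof.
move=> szN; have N_gt2 : 2 < N.
  by move: szN (dsize_gt0 (dlist a)) (dsize_gt0 (dlist b)) => /=; lia.
apply: (runs_triple szN).
apply: triple_weaken; [|shelve|by move=> st'; apply].
apply: triple_seq; apply: triple_assign => //=; first by move: szN => /=; lia.
apply: triple_seq; apply: triple_assign => //=; first by move: szN => /=; lia.
apply: triple_seq; apply: triple_assign => //=.
apply: triple_seq.
(* [r] turns false for good once [s2] is exhausted before [s1]; [s2] then stays empty, the tail of
   [Leaf] being [Leaf]. *)
apply: (triple_while N_gt2 (I := fun k st => exists s1 s2 r,
  [/\ st 1 = dlist s1, st 2 = dlist s2, st 3 = data_of_bool r,
      [/\ size s1 = k, dsize (dlist s1) <= N & dsize (dlist s2) <= N]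
    & r && (size s1 <= size s2) = (size a <= size b)]) _ _ (k := size a)).
- move=> k st [[|y s] [s2 [r [st1 st2 st3 _ er]]]] /=; rewrite st1 // => _.
  apply: triple_assign => //=; first by rewrite st3; case: (r) => /=; lia.
  by rewrite /update /= st3 -er andbT.
- move=> k st [[|y s] [s2 [r [st1 st2 st3 [szs s1N s2N] er]]]] /=; rewrite st1 // => _.
  apply: triple_seq; apply: triple_if => //=; rewrite st2.
    case: s2 => [|z s2] //= in st2 s2N er * => _.
    apply: triple_skip; apply: triple_seq; apply: triple_assign => //=.
      by rewrite st1 /=; move: s1N => /=; lia.
    apply: triple_assign => //=; rewrite /update /= st2; first by lia.
    exists (size s); first by rewrite -szs.
    exists s, s2, r; rewrite st1; split=> //.
    by split=> //; move: s1N => /=; lia.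
  case: s2 => [|z s2] //= in st2 s2N er * => _.
  apply: triple_assign => //=.
  apply: triple_seq; apply: triple_assign => //=.
    by rewrite /update /= st1 /=; move: s1N => /=; lia.
  apply: triple_assign => //=; rewrite /update /= st2 //.
  exists (size s); first by rewrite -szs.
  exists s, [::], false; rewrite st1; split=> //.
    by split=> //; move: s1N => /=; lia.
  by rewrite -er andbF.
- exists a, b, true; rewrite /update /=; split=> //.
  by move: szN => /=; split=> //; lia.
Unshelve.
rewrite /short_time /=.
have : size a <= N by move: szN (size_dlist a) => /=; lia.
nia.
Qed.

(** * Codes of sets *)

Lemma code_nat_inj : injective code_nat.
Proof.
have inj : injective code_pos.
  by elim=> [p IH|p IH|] [q|q|] //= [] /IH->.
by move=> m n /inj /SuccNat2Pos.inj.
Qed.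

Lemma dlist_inj : injective dlist.
Proof. by elim=> [|x s IH] [|y r] //= [-> /IH->]. Qed.

(** This lets [Eq] on codes decide equality of elements. An edge is recovered from its code because
    sorting keeps the members. *)
Lemma code_element_inj : injective code_element.
Proof.
move=> [v|e] [w|f] //= [].
  by move/code_nat_inj->.
move/dlist_inj/(inj_map code_nat_inj)=> ef.
suff -> : e = f by [].
by apply/fsetP=> x; rewrite -(mem_sort leq) ef mem_sort.
Qed.

(** Justifies the loop tests: comparing a code with [Leaf] tests whether the set is empty. *)
Lemma codes_set_nil d S : codes_set d S -> d = Leaf <-> S = fset0.
Proof.
move=> [s [_ Ss ->]]; split=> [|S0]; case: s => [|x s] // in Ss *.
  by move=> _; apply/fsetP=> x; rewrite Ss.
by have := Ss x; rewrite S0 in_fset0 mem_head.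
Qed.

Lemma codes_set_card (s : seq element) (S : {fset element}) :
  uniq s -> S =i s -> #|` S| = size s.
Proof. by move=> us Ss; apply/perm_size/uniq_perm. Qed.

Lemma dsize_dlist l : dsize (dlist l) = (\sum_(x <- l) (dsize x).+1).+1.
Proof.
elim: l => [|x l IH] /=; first by rewrite big_nil.
by rewrite big_cons IH; lia.
Qed.

(** All codes of a set are permutations of one list, so their size is a sum over its elements and
    grows with the set. Every stored set is thus bounded by the code of [elements G1] or of
    [elements G2]. *)
Lemma codes_set_dsize d d' S S' :
  codes_set d S -> codes_set d' S' -> S `<=` S' -> dsize d <= dsize d'.
Proof.
move=> [s [us Ss ->]] [s' [us' Ss' ->]] /fsubsetP sub.
rewrite !dsize_dlist !big_map ltnS.
rewrite (perm_big [seq x <- s' | x \in s]) /=; last first.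
  apply: uniq_perm; rewrite ?filter_uniq // => x.
  by rewrite mem_filter; case: (boolP (x \in s)) => //; rewrite -Ss -Ss' => /sub->.
by rewrite big_filter [leqRHS](bigID (mem s)) leq_addr.
Qed.

Lemma sieve_prog_codes keep N a b A C :
  codes_set a A -> codes_set b C -> dsize (Node a b) <= N ->
  exists t d, [/\ t <= sieve_time N, runs (sieve_prog keep) (Node a b) d t
    & codes_set d (if keep then A `&` C else A `\` C)].
Proof.
move=> [s [us As ->]] [r [ur Cr ->]] szN.
have [t tT run] := sieve_prog_runs keep szN.
exists t; eexists; split; [exact: tT|exact: run|].
exists (rev [seq x <- s | (x \in r) == keep]); split.
- by rewrite rev_uniq filter_uniq.
- move=> x; rewrite mem_rev mem_filter -As -Cr.
  by case: keep {run}; rewrite !inE ?eqb_id ?eqbF_neg // andbC.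
- rewrite map_rev filter_map; congr (dlist (rev (map _ _))).
  by apply: eq_filter => x /=; rewrite mem_map //; apply: code_element_inj.
Qed.

Lemma inter_prog_codes N a b A C :
  codes_set a A -> codes_set b C -> dsize (Node a b) <= N ->
  exists t d, [/\ t <= sieve_time N, runs inter_prog (Node a b) d t
    & codes_set d (A `&` C)].
Proof. exact: (sieve_prog_codes true). Qed.

Lemma diff_prog_codes N a b A C :
  codes_set a A -> codes_set b C -> dsize (Node a b) <= N ->
  exists t d, [/\ t <= sieve_time N, runs diff_prog (Node a b) d t
    & codes_set d (A `\` C)].
Proof. exact: (sieve_prog_codes false). Qed.

Lemma short_prog_codes N a b A C :
  codes_set a A -> codes_set b C -> dsize (Node a b) <= N ->
  exists2 t, t <= short_time N &
    runs short_prog (Node a b) (data_of_bool (#|` A| <= #|` C|)) t.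
Proof.
move=> [s [us As ->]] [r [ur Cr ->]] szN.
rewrite (codes_set_card us As) (codes_set_card ur Cr).
rewrite -(size_map code_element s) -(size_map code_element r).
exact: short_prog_runs.
Qed.

(** * Optimal solutions and the approximation ratio *)

(** Holds because the coefficients are natural numbers; it replaces the time bounds of the single
    queries to [B] by one bound at [N]. *)
Lemma horner_nat_mono (p : {poly nat}) m n : m <= n -> p.[m]%R <= p.[n]%R.
Proof.
move=> mn; rewrite !horner_coef; apply: leq_sum => i _.
by apply: leq_mul => //; elim: (val i) => // k IH; rewrite !exprS; apply: leq_mul.
Qed.

Lemma optima_sub (R : rcfType) (T : choiceType) g (F : T -> R) (A : {fset T}) x :
  x \in optima g F A -> x \in A.
Proof. by rewrite !inE => /andP[]. Qed.

Lemma optima_q_capP (R : rcfType) Y (A : {fset {fset element}}) S :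
  S \in optima Max (@q_cap R Y) A ->
  S \in A /\ forall S', S' \in A -> #|` Y `&` S'| <= #|` Y `&` S|.
Proof.
rewrite !inE => /andP[SA /allP opt]; split=> // S' /opt.
by rewrite /= ler_nat.
Qed.

Lemma optimal_solutions_sub (R : rcfType) (P : sp R) G S :
  sp_class P G -> S \in optimal_solutions P G -> S `<=` elements G.
Proof. by move=> PG /optima_sub; apply: sp_feasibleP. Qed.

(* With [b] the number of elements of [T1 & T2 & Y] lost to [T] and [a] that of
   [T1 & T2 & Y] itself, [a ^ 2 - (a - b) ^ 2 <= 2 * b * a], while [b <= v'] and
   [Y] loses at least [a] elements. *)
Lemma sqr_card_remove (K : choiceType) (Y T T1 T2 : {fset K}) chi v v' :
  #|` Y| <= chi -> v <= v' ->
  #|` Y `&` T1| <= #|` Y `&` T| -> #|` T `&` T2| <= v' ->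
  #|` T1 `&` T2| ^ 2 <= 2 * v * (chi - #|` Y|) + #|` T1 `&` T2 `&` Y| ^ 2 ->
  #|` T1 `&` T2| ^ 2 <=
    2 * v' * (chi - #|` Y `\` T|) + #|` T1 `&` T2 `&` (Y `\` T)| ^ 2.
Proof.
set Z := T1 `&` T2 => Ychi vv' maxT maxT2.
have eqY := cardfsID T Y.
have eqZ : #|` Z `&` Y `&` T| + #|` Z `&` (Y `\` T)| = #|` Z `&` Y|.
  by rewrite fsetIDA cardfsID.
have leb : #|` Z `&` Y `&` T| <= v'.
  apply: leq_trans maxT2; apply: fsubset_leq_card.
  by apply/fsubsetP => x; rewrite !inE => /andP[/andP[/andP[_ ->] _] ->].
have lea : #|` Z `&` Y| <= #|` Y `&` T|.
  apply: leq_trans maxT; apply: fsubset_leq_card.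
  by apply/fsubsetP => x; rewrite !inE => /andP[/andP[-> _] ->].
move: eqY eqZ leb lea Ychi.
set y := #|` Y|; set y' := #|` Y `\` T|; set c := #|` Y `&` T|.
set b := #|` Z `&` Y `&` T|; set a' := #|` Z `&` (Y `\` T)|.
set a := #|` Z `&` Y| => eqY eqZ leb lea Ychi.
(* Truncated subtraction is exact here, as [y = c + y'] and [y <= chi]. *)
have -> : chi - y' = (chi - y) + c by lia.
move: (chi - y) => e.
rewrite -!mulnn => H; apply: leq_trans H _.
have : v * e <= v' * e by rewrite leq_mul2r vv' orbT.
have : b * a <= v' * c by apply: leq_mul.
rewrite -eqZ; nia.
Qed.

Lemma sqrt_ratio (R : rcfType) (m v chi : nat) :
  0 < chi -> m ^ 2 <= 2 * chi * v ^ 2 ->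
  (1 / Num.sqrt (2 * chi%:R) * m%:R <= v%:R :> R)%R.
Proof.
move=> chi_gt0 le_m.
have s_gt0 : (0 < Num.sqrt (2 * chi%:R) :> R)%R.
  by rewrite sqrtr_gt0 mulr_gt0 ?ltr0n.
(* Clear the denominator and compare squares, both sides being nonnegative. *)
rewrite mul1r mulrC ler_pdivrMr // -(@ler_pXn2r _ 2) ?nnegrE ?mulr_ge0 ?ler0n ?(ltW s_gt0) //.
rewrite exprMn sqr_sqrtr; last by rewrite mulr_ge0 ?ler0n.
by rewrite -!natrX -!natrM ler_nat mulnC.
Qed.

(** Having a square at most [M] holds for 0 and is stable under [maxn], so it passes to iterated
    maxima, empty ranges included. *)
Lemma bigmax_le_sqr (I J : choiceType) (A : {fset I}) (C : {fset J})
    (F : I -> J -> nat) M :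
  (forall i j, i \in A -> j \in C -> F i j ^ 2 <= M) ->
  (\max_(i <- A) \max_(j <- C) F i j) ^ 2 <= M.
Proof.
have maxP m n : m ^ 2 <= M -> n ^ 2 <= M -> maxn m n ^ 2 <= M by rewrite /maxn; case: ifP.
move=> FM; rewrite big_seq; apply: (big_ind (fun m => m ^ 2 <= M)) => // i iA.
by rewrite big_seq; apply: (big_ind (fun m => m ^ 2 <= M)) => // j jC; apply: FM.
Qed.

(** * The two-loop algorithm *)

(** The local command of [two_loop], named so that it can have its own triple; likewise for the two
    loops below. *)
Definition keep_best : cmd :=
  (Call 11 inter_prog (ECons (Var 4) (Var 5)) ;;
   Call 12 inter_prog (ECons (Var 6) (Var 7)) ;;
   Call 13 short_prog (ECons (Var 11) (Var 12)) ;;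
   If (Var 13) (4 ::= Var 6 ;; 5 ::= Var 7) Skip)%cmd.

Definition keep_best_time N := 99 * N + 2 * sieve_time N + short_time N.

Section TwoLoop.
Variables (R : rcfType) (P : sp R) (B : cmd) (q : {poly nat}).
Hypothesis B_spec : forall (G H : egraph) (Y : {fset element}) (dG dY : data),
  sp_class P G -> sp_class P H -> Y `<=` elements H ->
  codes_egraph dG G -> codes_set dY Y ->
  exists (dS : data) (S : {fset element}) (t : nat),
    [/\ runs B (Node dG dY) dS t, t <= q.[dsize (Node dG dY)]%R, codes_set dS S
      & S \in optima Max (@q_cap R Y) (optimal_solutions P G)].
Variables (G1 G2 : egraph) (a1 a2 : data).
Hypotheses (PG1 : sp_class P G1) (PG2 : sp_class P G2).
Hypotheses (code1 : codes_set a1 (elements G1)) (code2 : codes_set a2 (elements G2)).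

Variables (d1 d2 : data) (N : nat).
Hypotheses (d1E : d1 = Node a1 (enrichment G1)) (d2E : d2 = Node a2 (enrichment G2)).
Hypothesis le_N : dsize (Node d1 d2) <= N.
Let O1 := optimal_solutions P G1.
Let O2 := optimal_solutions P G2.
Let X := elements G1 `&` elements G2.

(** * Queries to [B] and sizes of stored values *)

Lemma B_query G H Y dG dY :
  sp_class P G -> sp_class P H -> Y `<=` elements H ->
  codes_egraph dG G -> codes_set dY Y -> dsize (Node dG dY) <= N ->
  exists t dS S, [/\ t <= q.[N]%R, runs B (Node dG dY) dS t, codes_set dS S,
    S \in optimal_solutions P G
    & forall S', S' \in optimal_solutions P G -> #|` Y `&` S'| <= #|` Y `&` S|].
Proof.
move=> PG PH YH cG cY szN.
have [dS [S [t [run tq cS /optima_q_capP[SO maxS]]]]] := B_spec PG PH YH cG cY.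
by exists t, dS, S; split=> //; apply: leq_trans tq (horner_nat_mono _ szN).
Qed.

(** The 5 counts the three nodes that pair up the input and the two enrichments, of size at least 1
    each. *)
Lemma sizeN : dsize a1 + dsize a2 + 5 <= N.
Proof.
move: le_N; rewrite d1E d2E /=.
by have := dsize_gt0 (enrichment G1); have := dsize_gt0 (enrichment G2); lia.
Qed.

Lemma N_gt2 : 2 < N. Proof. by have := sizeN; lia. Qed.

Lemma solution1_le d S : codes_set d S -> S `<=` elements G1 -> dsize d <= N.
Proof. by move=> cS /(codes_set_dsize cS code1); have := sizeN; lia. Qed.

Lemma solution2_le d S : codes_set d S -> S `<=` elements G2 -> dsize d <= N.
Proof. by move=> cS /(codes_set_dsize cS code2); have := sizeN; lia. Qed.

Lemma solutions_le d S d' S' :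
  codes_set d S -> S `<=` elements G1 -> codes_set d' S' -> S' `<=` elements G2 ->
  dsize (Node d d') <= N.
Proof.
move=> cS /(codes_set_dsize cS code1) ? cS' /(codes_set_dsize cS' code2) ?.
by have := sizeN; rewrite /=; lia.
Qed.

Lemma solutionsC_le d S d' S' :
  codes_set d S -> S `<=` elements G1 -> codes_set d' S' -> S' `<=` elements G2 ->
  dsize (Node d' d) <= N.
Proof. by move=> cS sS cS' sS'; move: (solutions_le cS sS cS' sS') => /=; lia. Qed.

(** The code [d] takes the place of [d2] in the input, so a query to [G1] is small enough once its
    set lies in [G2]; the roles are exchanged for [G2]. *)
Lemma query1_le d S : codes_set d S -> S `<=` elements G2 -> dsize (Node d1 d) <= N.
Proof.
move=> cS /(codes_set_dsize cS code2).
by move: le_N; rewrite d1E d2E /=; lia.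
Qed.

Lemma query2_le d S : codes_set d S -> S `<=` elements G1 -> dsize (Node d2 d) <= N.
Proof.
move=> cS /(codes_set_dsize cS code1).
by move: le_N; rewrite d1E d2E /=; lia.
Qed.

(** Optimality is asserted only for a nonempty intersection, because the initial pair of empty sets
    may fail to be optimal. *)
Definition best (st : store) (S1 S2 : {fset element}) : Prop :=
  [/\ codes_set (st 4) S1, codes_set (st 5) S2,
      S1 `<=` elements G1, S2 `<=` elements G2
    & 0 < #|` S1 `&` S2| -> S1 \in O1 /\ S2 \in O2].

(** The resulting pair is optimal in either case: a new pair is [T1], [T2], and an old pair survives
    only if its intersection is strictly larger than theirs, hence nonempty, so that [best]
    applies. *)
Lemma keep_best_triple st S1 S2 T1 T2 :
  best st S1 S2 -> codes_set (st 6) T1 -> codes_set (st 7) T2 ->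
  T1 \in O1 -> T2 \in O2 ->
  triple N keep_best st (keep_best_time N) (fun st' =>
    (forall x, x \notin [:: 4; 5; 11; 12; 13] -> st' x = st x) /\
    exists S1' S2', [/\ best st' S1' S2', S1' \in O1 /\ S2' \in O2,
      #|` S1 `&` S2| <= #|` S1' `&` S2'| & #|` T1 `&` T2| <= #|` S1' `&` S2'|]).
Proof.
move=> [c4 c5 sub1 sub2 SO] c6 c7 T1O T2O.
have Tsub1 := optimal_solutions_sub PG1 T1O.
have Tsub2 := optimal_solutions_sub PG2 T2O.
have N2 := N_gt2.
apply: triple_weaken; [|shelve|by move=> st'; apply].
apply: triple_seq.
have [t [d11 [tT run c11]]] := inter_prog_codes c4 c5 (solutions_le c4 sub1 c5 sub2).
have sub11 := fsubset_trans (fsubsetIl S1 S2) sub1.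
apply: (triple_call N2 _ tT); [exact: run|exact: solution1_le c11 sub11|].
apply: triple_seq.
have [{tT run}t [d12 [tT run c12]]] :=
  inter_prog_codes c6 c7 (solutions_le c6 Tsub1 c7 Tsub2).
have sub12 := fsubset_trans (fsubsetIr T1 T2) Tsub2.
apply: (triple_call N2 _ tT); [exact: run|exact: solution2_le c12 sub12|].
apply: triple_seq.
have [{tT run}t tT run] :=
  short_prog_codes c11 c12 (solutions_le c11 sub11 c12 sub12).
apply: (triple_call N2 _ tT); first exact: run.
  by case: (#|` _| <= _) => //; apply: ltnW (ltnW _).
apply: triple_if => // /=; rewrite /update /=; case: (leqP #|` _|) => // ltv _.
- apply: triple_seq; apply: triple_assign => //=; first exact: solution1_le c6 Tsub1.
  apply: triple_assign => //=; first exact: solution2_le c7 Tsub2.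
  rewrite /update; split.
    by move=> x; rewrite !inE !negb_or => /and5P[/negPf-> /negPf-> /negPf-> /negPf-> /negPf->].
  by exists T1, T2.
- apply: triple_skip; split.
    by move=> x; rewrite !inE !negb_or => /and5P[_ _ /negPf-> /negPf-> /negPf->].
  have [S1O S2O] : S1 \in O1 /\ S2 \in O2 by apply: SO; apply: leq_ltn_trans ltv.
  by exists S1, S2; split=> //; exact: ltnW.
Unshelve.
by rewrite /keep_best_time; move: N2; clear; move: (sieve_time N) (short_time N) => /=; lia.
Qed.

Lemma codes1 : codes_egraph d1 G1. Proof. by exists a1. Qed.
Lemma codes2 : codes_egraph d2 G2. Proof. by exists a2. Qed.

(** * First loop: reaching an optimal pair *)

Definition first_loop : cmd :=
  (While (Var 8) (
    Call 6 B (ECons (Var 1) (ECons (Hd (Var 8)) ENil)) ;;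
    Call 7 B (ECons (Var 2) (Var 6)) ;;
    keep_best ;;
    8 ::= Tl (Var 8)))%cmd.

Definition loop_time :=
  200 * (N + q.[N]%R + sieve_time N + short_time N).

Lemma first_loop_triple st S1 S2 :
  st 1 = d1 -> st 2 = d2 -> codes_set (st 3) X -> st 8 = st 3 -> best st S1 S2 ->
  triple N first_loop st (N + N * (N + loop_time)) (fun st' =>
    [/\ st' 1 = d1, st' 2 = d2 & codes_set (st' 3) X] /\
    exists S1' S2', best st' S1' S2' /\ (0 < #|` X| -> S1' \in O1 /\ S2' \in O2)).
Proof.
move=> e1 e2 c3 e8 b0; have N2 := N_gt2.
have [s0 [us0 Xs0 es0]] := c3.
have s0N : size s0 <= N.
  apply: leq_trans (solution1_le c3 (fsubsetIl _ _)).
  by rewrite es0; have := size_dlist (map code_element s0); rewrite size_map.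
apply: (@triple_weaken _ _ _ (N + size s0 * (N + loop_time))); first last.
- by move=> st'; apply.
- by rewrite leq_add2l leq_mul2r s0N orbT.
(* [s] lists the elements still to be processed. By the last clause the pair is optimal unless all
   of [X] is still in [s], so at the exit any element of [X] yields optimality. *)
pose I k st := exists s S1 S2,
  [/\ [/\ st 1 = d1, st 2 = d2 & codes_set (st 3) X],
      [/\ st 8 = dlist (map code_element s), size s = k & {subset s <= X}],
      best st S1 S2
    & forall x, x \in X -> x \in s \/ S1 \in O1 /\ S2 \in O2].
(* The loop test is a variable, of [esize] 1; this matches the time in [triple_while]. *)
rewrite -[N in N + _]mul1n -[N in N + loop_time]mul1n.
apply: (triple_while N2 (I := I)).
- move=> {c3 e8 b0 e1 e2 S1 S2 es0 st} k st [[|y s] [S1 [S2 [eqs [/= -> _ _] b fin]]]] // _.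
  split=> //; exists S1, S2; split=> //.
  by rewrite cardfs_gt0 => /fset0Pn[x /fin[|]].
- move=> {c3 e8 b0 e1 e2 S1 S2 es0 st} k st [[|y s] [S1 [S2 [[e1 e2 c3] [/= e8 szs subX] b fin]]]].
    by rewrite e8.
  (* The bound on the current list is needed when its tail is assigned. *)
  move=> _; apply: triple_bounded => bst.
  have := bst 8; rewrite e8 => sz8.
  have yX : y \in X by apply: subX; rewrite inE eqxx.
  have cy : codes_set (Node (code_element y) Leaf) [fset y].
    by exists [:: y]; split=> // x; rewrite !inE.
  have suby1 : [fset y] `<=` elements G1.
    by rewrite fsub1set; move: yX; rewrite inE => /andP[].
  have suby2 : [fset y] `<=` elements G2.
    by rewrite fsub1set; move: yX; rewrite inE => /andP[].
  have [t1 [b1 [T1 [t1T run1 c1 T1O _]]]] := B_query PG1 PG1 suby1 codes1 cy (query1_le cy suby2).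
  have Tsub1 := optimal_solutions_sub PG1 T1O.
  have [t2 [b2 [T2 [t2T run2 c2 T2O _]]]] := B_query PG2 PG1 Tsub1 codes2 c1 (query2_le c1 Tsub1).
  have Tsub2 := optimal_solutions_sub PG2 T2O.
  apply: triple_weaken; [|shelve|by move=> st'; apply].
  apply: triple_seq; apply: (triple_call N2 _ t1T); first by rewrite /= e1 e8; exact: run1.
    exact: solution1_le c1 Tsub1.
  apply: triple_seq; apply: (triple_call N2 _ t2T); first by rewrite /update /= e2; exact: run2.
    exact: solution2_le c2 Tsub2.
  apply: triple_seq; apply: triple_post.
    by apply: (keep_best_triple (S1 := S1) (S2 := S2) (T1 := T1) (T2 := T2)).
  move=> st' [unch [S1' [S2' [b' SO' _ _]]]].
  have e8' : st' 8 = dlist (map code_element (y :: s)) by rewrite unch.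
  apply: triple_assign => //=; first by rewrite e8'; move: sz8 => /=; clear; lia.
  exists (size s); first by rewrite -szs.
  exists s, S1', S2'; split=> //.
  + by rewrite /update /= !unch.
  + rewrite /update /= e8'; split=> // x xs.
    by apply: subX; rewrite inE xs orbT.
  + by move=> x xX; right.
- exists s0, S1, S2; split=> //; first by split=> //; [rewrite e8|move=> x; rewrite -Xs0].
  by move=> x xX; left; rewrite -Xs0.
Unshelve.
by rewrite /loop_time /keep_best_time; move: N2; clear; move: q.[N]%R (sieve_time N) (short_time N) => /=; lia.
Qed.

(** * Second loop: the inequality between squares *)

Definition second_loop : cmd :=
  (While (Var 10) (
    Call 7 B (ECons (Var 2) (Var 6)) ;;
    keep_best ;;
    Call 9 diff_prog (ECons (Var 9) (Var 6)) ;;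
    Call 6 B (ECons (Var 1) (Var 9)) ;;
    Call 10 inter_prog (ECons (Var 6) (Var 9))))%cmd.

(** The query with all of [X] is made before the loop, so its answer [T] appears in the
    hypotheses. *)
Lemma second_loop_triple st T S1 S2 :
  st 1 = d1 -> st 2 = d2 -> codes_set (st 9) X -> codes_set (st 6) T ->
  T \in O1 -> (forall T1, T1 \in O1 -> #|` X `&` T1| <= #|` X `&` T|) ->
  codes_set (st 10) (T `&` X) -> best st S1 S2 ->
  (0 < #|` X| -> S1 \in O1 /\ S2 \in O2) ->
  triple N second_loop st (N + N * (N + loop_time)) (fun st' =>
    exists S1' S2', [/\ best st' S1' S2',
      0 < #|` X| -> S1' \in O1 /\ S2' \in O2
      & forall T1 T2, T1 \in O1 -> T2 \in O2 ->
          #|` T1 `&` T2| ^ 2 <= 2 * #|` X| * #|` S1' `&` S2'| ^ 2]).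
Proof.
move=> e1 e2 c9 c6 TO maxT c10 b0 SO; have N2 := N_gt2.
have XN : #|` X| <= N.
  apply: leq_trans (solution1_le c9 (fsubsetIl _ _)).
  have [s [us Xs ->]] := c9; rewrite (codes_set_card us Xs).
  by have := size_dlist (map code_element s); rewrite size_map.
apply: (@triple_weaken _ _ _ (N + #|` X| * (N + loop_time))); first last.
- by move=> st'; apply.
- by rewrite leq_add2l leq_mul2r XN orbT.
(* [T] is the answer of [B] to the current [Y], whose cardinality is the variant. The last clause is
   the quadratic bound, kept for all optimal [T1], [T2] at once. *)
pose I k st := exists Y T S1 S2,
  [/\ [/\ st 1 = d1, st 2 = d2 & best st S1 S2],
      [/\ codes_set (st 9) Y, Y `<=` X & #|` Y| = k],
      [/\ codes_set (st 6) T, T \in O1,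
          (forall T1, T1 \in O1 -> #|` Y `&` T1| <= #|` Y `&` T|)
        & codes_set (st 10) (T `&` Y)],
      (0 < #|` X| -> S1 \in O1 /\ S2 \in O2)
    & (forall T1 T2, T1 \in O1 -> T2 \in O2 ->
       #|` T1 `&` T2| ^ 2 <= 2 * #|` S1 `&` S2| * (#|` X| - #|` Y|)
         + #|` T1 `&` T2 `&` Y| ^ 2)].
rewrite -[N in N + _]mul1n -[N in N + loop_time]mul1n.
have subX1 : X `<=` elements G1 by apply: fsubsetIl.
have subX2 : X `<=` elements G2 by apply: fsubsetIr.
apply: (triple_while N2 (I := I)).
- move=> {st e1 e2 c9 c6 TO maxT c10 b0 SO T S1 S2} k st.
  move=> [Y [T [S1 [S2 [[_ _ b] _ [_ TO maxT c10] SO fin]]]]] /= e10.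
  exists S1, S2; split=> // T1 T2 T1O T2O; have := fin _ _ T1O T2O.
  (* At the exit [T] misses [Y]; by its maximality, so does every optimal [T1]. *)
  have YT1 : Y `&` T1 = fset0.
    apply/eqP; rewrite -cardfs_eq0 -leqn0; apply: leq_trans (maxT _ T1O) _.
    by move/(codes_set_nil c10): e10; rewrite fsetIC => ->; rewrite cardfs0.
  have -> : T1 `&` T2 `&` Y = fset0.
    by rewrite fsetIAC (fsetIC T1) YT1 fset0I.
  rewrite cardfs0 addn0 => le_sq; apply: leq_trans le_sq _.
  rewrite -!mulnA leq_mul2l /= [leqRHS]mulnC leq_mul ?leq_subr //.
  by rewrite -mulnn; case: #|` S1 `&` S2| => // v; rewrite leq_pmulr.
- move=> {st e1 e2 c9 c6 TO maxT c10 b0 SO T S1 S2} k st.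
  move=> [Y [T [S1 [S2 [[e1 e2 b] [c9 YX cardY] [c6 TO maxT c10] SO fin]]]]] /= n10.
  have Tsub := optimal_solutions_sub PG1 TO.
  have [t2 [b2 [U [t2T run2 c2 UO maxU]]]] := B_query PG2 PG1 Tsub codes2 c6 (query2_le c6 Tsub).
  have Usub := optimal_solutions_sub PG2 UO.
  have Ysub := fsubset_trans YX subX2.
  have [t3 [b3 [t3T run3 c3]]] := diff_prog_codes c9 c6 (solutionsC_le c6 Tsub c9 Ysub).
  have Y'X : Y `\` T `<=` X := fsubset_trans (fsubsetDl _ _) YX.
  have Y'sub := fsubset_trans Y'X subX2.
  have [t4 [b4 [T' [t4T run4 c4 T'O maxT']]]] :=
    B_query PG1 PG2 Y'sub codes1 c3 (query1_le c3 Y'sub).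
  have T'sub := optimal_solutions_sub PG1 T'O.
  have [t5 [b5 [t5T run5 c5]]] := inter_prog_codes c4 c3 (solutions_le c4 T'sub c3 Y'sub).
  apply: triple_weaken; [|shelve|by move=> st'; apply].
  apply: triple_seq; apply: (triple_call N2 _ t2T); first by rewrite /= e2; exact: run2.
    exact: solution2_le c2 Usub.
  apply: triple_seq; apply: triple_post.
    by apply: (keep_best_triple (S1 := S1) (S2 := S2) (T1 := T) (T2 := U)).
  move=> st' [unch [S1' [S2' [b' SO' leS leU]]]].
  apply: triple_seq; apply: (triple_call N2 _ t3T).
    by rewrite /= !unch //; exact: run3.
    exact: solution2_le c3 Y'sub.
  apply: triple_seq; apply: (triple_call N2 _ t4T).
    by rewrite /update /= !unch // /update /= e1; exact: run4.
    exact: solution1_le c4 T'sub.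
  apply: (triple_call N2 _ t5T); first by rewrite /update /=; exact: run5.
    exact: solution2_le c5 (fsubset_trans (fsubsetIr _ _) Y'sub).
  (* The variant drops: the loop test says that [T] meets [Y]. *)
  exists #|` Y `\` T|.
    rewrite -cardY -(cardfsID T Y) -[ltnLHS]add0n ltn_add2r cardfs_gt0.
    by apply/eqP=> YT0; apply/n10/(codes_set_nil c10); rewrite fsetIC.
  exists (Y `\` T), T', S1', S2'; split=> //.
  + by rewrite /update /= !unch.
  + move=> T1 T2 T1O T2O.
    apply: sqr_card_remove _ leS _ _ (fin _ _ T1O T2O); [exact: fsubset_leq_card|exact: maxT|].
    (* No optimal [T2] meets [T] in more elements than [U] does, and the updated pair is at least as
       good as [T], [U]. *)
    exact: leq_trans (maxU _ T2O) leU.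
- exists X, T, S1, S2; split=> // T1 T2 T1O T2O.
  (* At the start [Y] is [X]: the first summand vanishes, and optimal solutions meet only in common
     elements. *)
  rewrite subnn muln0 add0n; suff -> : T1 `&` T2 `&` X = T1 `&` T2 by [].
  apply/fsetIidPl; apply: fsetISS.
    exact: optimal_solutions_sub PG1 T1O.
  exact: optimal_solutions_sub PG2 T2O.
Unshelve.
by rewrite /loop_time /keep_best_time; move: N2; clear; move: q.[N]%R (sieve_time N) (short_time N) => /=; lia.
Qed.

(** * The whole program *)

Definition two_loop_time := 3 * (N + 1) * (N + loop_time).

(** The ratio is kept as an inequality between squares of naturals. If [X] is empty, neither loop
    runs and the initial pair is returned, whence the condition on the cardinality of [X]. *)
Lemma two_loop_triple :
  triple N (two_loop B) (init (Node d1 d2)) two_loop_time (fun st =>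
    exists e1 e2 S1 S2, [/\ st 0 = Node e1 e2, codes_set e1 S1, codes_set e2 S2,
      0 < #|` X| -> S1 \in O1 /\ S2 \in O2
      & forall T1 T2, T1 \in O1 -> T2 \in O2 ->
          #|` T1 `&` T2| ^ 2 <= 2 * #|` X| * #|` S1 `&` S2| ^ 2]).
Proof.
have N2 := N_gt2.
have subX1 : X `<=` elements G1 by apply: fsubsetIl.
have subX2 : X `<=` elements G2 by apply: fsubsetIr.
have Leaf_N : dsize Leaf <= N by apply: ltnW (ltnW _).
apply: triple_weaken; [|shelve|by move=> st'; apply].
apply: triple_seq; apply: triple_assign => //.
  by move: le_N => /=; clear; lia.
apply: triple_seq; apply: triple_assign => //.
  by move: le_N => /=; clear; lia.
have [t1 [b1 [t1T run1 c1]]] :=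
  inter_prog_codes code1 code2 (solutions_le code1 (fsubset_refl _) code2 (fsubset_refl _)).
apply: triple_seq; apply: (triple_call N2 _ t1T).
- by rewrite /= /update /= d1E d2E; exact: run1.
- exact: solution1_le c1 subX1.
apply: triple_seq; apply: triple_assign => //.
apply: triple_seq; apply: triple_assign => //.
apply: triple_seq; apply: triple_assign => //; first exact: solution1_le c1 subX1.
apply: triple_seq; apply: triple_post.
  apply: (first_loop_triple (S1 := fset0) (S2 := fset0)) => //.
  (* [Leaf] codes the empty set, and the optimality clause of [best] is vacuous for the initial
     pair. *)
  by split=> //; rewrite ?fsub0set ?fset0I ?cardfs0 //; exists [::].
move=> st [[e1 e2 c3] [S1 [S2 [b0 SO]]]].
apply: triple_seq; apply: triple_assign => //; first exact: solution1_le c3 subX1.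
have [t2 [b2 [T [t2T run2 c2 TO maxT]]]] :=
  B_query PG1 PG1 subX1 codes1 c3 (query1_le c3 subX2).
have Tsub := optimal_solutions_sub PG1 TO.
apply: triple_seq; apply: (triple_call N2 _ t2T).
- by rewrite /= /update /= e1; exact: run2.
- exact: solution1_le c2 Tsub.
have [t4 [b4 [t4T run4 c4]]] := inter_prog_codes c2 c3 (solutions_le c2 Tsub c3 subX2).
apply: triple_seq; apply: (triple_call N2 _ t4T); first exact: run4.
  exact: solution1_le c4 (fsubset_trans (fsubsetIl _ _) Tsub).
apply: triple_seq; apply: triple_post.
  by apply: (second_loop_triple (T := T) (S1 := S1) (S2 := S2)).
move=> {b0 SO}st' [S1' [S2' [[c4' c5 sub1 sub2 _] SO ratio]]].
apply: triple_assign => //; first exact: solutions_le c4' sub1 c5 sub2.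
by exists (st' 4), (st' 5), S1', S2'.
Unshelve.
rewrite /two_loop_time /loop_time; move: N2; clear; move: q.[N]%R (sieve_time N) (short_time N) => /=; nia.
Qed.

End TwoLoop.

(** * The time polynomial and the square root *)

Local Open Scope ring_scope.

Theorem theorem2 (R : rcfType) (P : sp R) (B : cmd)
    (hB : preficiency_algorithm (MSP P (@q_cap R) Max) B) :
  exists p : {poly nat},
  forall (G1 G2 : egraph) (d1 d2 : data),
    sp_class P G1 -> sp_class P G2 ->
    codes_egraph d1 G1 -> codes_egraph d2 G2 ->
    exists (e1 e2 : data) (S1 S2 : {fset element}) (t : nat),
      [/\ runs (two_loop B) (Node d1 d2) (Node e1 e2) t,
          (t <= p.[dsize (Node d1 d2)])%N,
          codes_set e1 S1, codes_set e2 S2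
        & (0 < intertwinement G1 G2)%N ->
          [/\ S1 \in optimal_solutions P G1,
              S2 \in optimal_solutions P G2
            & 1 / Num.sqrt (2 * (intertwinement G1 G2)%:R) *
                (\max_(T1 <- optimal_solutions P G1)
                   \max_(T2 <- optimal_solutions P G2) #|` T1 `&` T2|)%:R
              <= (#|` S1 `&` S2|)%:R :> R]].
Proof.
have [q B_spec] := hB.
(* This is [two_loop_time] with the indeterminate for [N] and with [loop_time], [sieve_time] and
   [short_time] expanded. *)
exists (3%:P * ('X + 1%:P) * ('X + 200%:P * ('X + q + 300%:P * 'X * 'X * 'X + 99%:P * 'X * 'X))).
move=> G1 G2 d1 d2 PG1 PG2 [a1 code1 d1E] [a2 code2 d2E].
(* [N] is taken to be the size of the input itself. *)
have [st [t [ex tT _ [e1 [e2 [S1 [S2 [st0 c1 c2 SO ratio]]]]]]]] :=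
  two_loop_triple B_spec PG1 PG2 code1 code2 d1E d2E (leqnn _) (bounded_init (leqnn _)).
exists e1, e2, S1, S2, t; split=> //; first by exists st.
  by rewrite !(hornerD, hornerM, hornerC, hornerX).
move=> chi_gt0; have [S1O S2O] := SO chi_gt0; split=> //.
apply: sqrt_ratio => //; apply: bigmax_le_sqr => T1 T2; exact: ratio.
Qed.
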